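(* Let $m,k$ be integers with $1\le m$, $k\le N-1$, $k-m>1$, such that $$\phi^{m-1}-\phi^m>\phi^m-\phi^{m+1}=\cdots=\phi^{k-1}-\phi^k>\phi^k-\phi^{k+1},$$ and let ${\tt Z}\in\aleph_k^\bullet$ be a labeled atom such that ${\tt N}^{out}_{\tt Z}(F)=\emptyset$ for every $F\in\tilde{\cal F}^{k-1}$. Then for every $l=m,m+1,\ldots,k$: $\tilde{\cal F}^l|_{\uparrow{\tt Z}}=\tilde{\cal F}^l|_{\tt Z}=\tilde{\cal T}^\bullet_{\tt Z}$; that is, for every $F\in\tilde{\cal F}^l$, $F|_{\uparrow{\tt Z}}=F|_{\tt Z}\in\tilde{\cal T}^\bullet_{\tt Z}$, and for every $T\in\tilde{\cal T}^\bullet_{\tt Z}$ there exists $Q\in\tilde{\cal F}^l$ with $Q|_{\uparrow{\tt Z}}=Q|_{\tt Z}=T$.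
   Context: $V$ is a directed graph without loops on a finite vertex set ${\tt N}$, $|{\tt N}|=N$; each arc $(i,j)$ has a real weight $v_{ij}$; $V$ is assumed to have at least one spanning tree. An (entering) forest is a directed graph in which at most one arc leaves each vertex and there are no directed cycles; its components are trees, the root of a tree being its unique vertex with no outgoing arc. All forests and trees are subgraphs of $V$. For a subgraph $G$ and ${\tt D}\subseteq{\tt N}$, $\Upsilon^G_{\tt D}=\sum_{i\in{\tt D},(i,j)\in G}v_{ij}$ (heads may lie outside ${\tt D}$), $\Upsilon^G=\Upsilon^G_{\tt N}$. ${\cal F}^j$: spanning forests of $V$ with exactly $j$ trees; $\phi^j=\min_{F\in{\cal F}^j}\Upsilon^F$ ($\phi^j=\infty$ if ${\cal F}^j=\emptyset$; $\phi^0=\infty$); $\tilde{\cal F}^j$: forests in ${\cal F}^j$ of weight $\phi^j$. $\mathfrak{A}_k$: algebra of subsets of ${\tt N}$ generated by the vertex sets of all trees of all forests in $\tilde{\cal F}^k$; $\aleph_k$: its atoms (nonempty elements ${\tt A}$ with ${\tt A}\cap{\tt B}\in\{\emptyset,{\tt A}\}$ for all ${\tt B}\in\mathfrak{A}_k$); $\aleph_k^\bullet$: labeled atoms (containing a root of some tree of some $F\in\tilde{\cal F}^k$). For ${\tt D}\subseteq{\tt N}$: ${\cal T}^\bullet_{\tt D}$ is the set of trees with vertex set ${\tt D}$, $\lambda^\bullet_{\tt D}=\min_{T\in{\cal T}^\bullet_{\tt D}}\Upsilon^T$, $\tilde{\cal T}^\bullet_{\tt D}=\{T\in{\cal T}^\bullet_{\tt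 D}:\Upsilon^T=\lambda^\bullet_{\tt D}\}$. $G|_{\tt D}$ is the induced subgraph on ${\tt D}$. ${\tt N}^{out}_{\tt D}(G)$ is the set of heads $j\notin{\tt D}$ of arcs $(i,j)\in G$ with $i\in{\tt D}$. The outgoing restriction $G|_{\uparrow{\tt D}}$ has as arcs exactly the arcs of $G$ with tail in ${\tt D}$ and vertex set ${\tt D}\cup{\tt N}^{out}_{\tt D}(G)$. *)

(* Defs.v *)
From mathcomp Require Import all_boot all_order all_algebra.
From mathcomp Require Import constructive_ereal reals.

Set Implicit Arguments.
Unset Strict Implicit.
Unset Printing Implicit Defensive.

Import Order.TTheory GRing.Theory Num.Theory.
Local Open Scope ring_scope.

(* A directed graph whose vertices lie in the ambient finite vertex set T,
   given by its vertex set and its arc set; the arc (i, j) goes from i to j.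
   That arcs join vertices of the graph is required by [subgraph]. *)
Definition digraph (T : finType) : finType := ({set T} * {set T * T})%type.

Section Digraphs.
Variable T : finType.
Implicit Types (G F : digraph T) (D : {set T}) (E : {set T * T}).

Definition vset G : {set T} := G.1.
Definition arcs G : {set T * T} := G.2.

Definition has_arc G : rel T := fun i j => (i, j) \in arcs G.

Definition loopless E : bool := [forall i, (i, i) \notin E].

(* [E] is the arc set of the ambient graph V, whose vertex set is all of T. *)
Definition subgraph E G : bool :=
  (arcs G \subset E)
    && [forall e in arcs G, (e.1 \in vset G) && (e.2 \in vset G)].

Definition acyclic G : bool :=
  [forall e in arcs G, ~~ connect (has_arc G) e.2 e.1].

Lemma acyclicP G :
  reflect (forall c : seq T, ucycle (has_arc G) c -> c = [::]) (acyclic G).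
Proof.
apply: (iffP forall_inP) => [acG [//|x c] /andP[cyc _] | noc [x y] xy /=].
  move: cyc; case: c => [|y c] /=.
    by rewrite andbT => xx; move: (acG _ xx); rewrite connect0.
  case/andP=> xy pth; case/negP: (acG _ xy) => /=.
  by apply/connectP; exists (rcons c x); rewrite ?last_rcons.
apply/negP => /connectP[p pth def_x].
case/shortenP: pth def_x => q pth uq _ def_x.
have /noc // : ucycle (has_arc G) (y :: q).
by rewrite /ucycle uq andbT /= rcons_path pth /= -def_x.
Qed.

Definition is_forest G : bool :=
  [forall i, #|[set j | has_arc G i j]| <= 1]%N && acyclic G.

Definition uarc G : rel T := fun i j => has_arc G i j || has_arc G j i.

(* Connectivity ignores arc directions; an element is the vertex set of a
   component. *)
Definition components G : {set {set T}} :=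
  equivalence_partition (connect (uarc G)) (vset G).

Definition is_tree G : bool := is_forest G && (#|components G| == 1%N).

(* Meant for D contained in [vset G], as holds for spanning G. *)
Definition induced G D : digraph T :=
  (D, [set e in arcs G | (e.1 \in D) && (e.2 \in D)]).

Definition Nout D G : {set T} :=
  [set j | (j \notin D) && [exists i in D, has_arc G i j]].

Definition outres G D : digraph T :=
  (D :|: Nout D G, [set e in arcs G | e.1 \in D]).

Definition trees F : {set digraph T} := [set induced F C | C in components F].

Definition is_root G i : bool := (i \in vset G) && [forall j, ~~ has_arc G i j].

Definition spanning_forests E (j : nat) : {set digraph T} :=
  [set F | [&& subgraph E F, is_forest F, vset F == setT
             & #|components F| == j]].

Definition trees_on E D : {set digraph T} :=
  [set G | [&& subgraph E G, is_tree G & vset G == D]].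

Definition set_algebra (S : {set {set T}}) : bool :=
  [&& setT \in S, [forall A in S, ~: A \in S]
    & [forall A in S, [forall B in S, A :|: B \in S]]].

Definition generated_algebra (S : {set {set T}}) : {set {set T}} :=
  \bigcap_(S' : {set {set T}} | set_algebra S' && (S \subset S')) S'.

Definition algebra_atoms (S : {set {set T}}) : {set {set T}} :=
  [set A in S | (A != set0)
     && [forall B in S, (A :&: B == set0) || (A :&: B == A)]].

Section Weights.
Variables (R : realType) (E : {set T * T}) (v : T -> T -> R).

Definition weight G : R := \sum_(e in arcs G) v e.1 e.2.

(* The minimum over the empty family is +oo; as T is nonempty whenever V has
   a spanning tree, this includes phi^0 = +oo. *)
Definition phi (j : nat) : \bar R :=
  \big[Order.min/+oo%E]_(F in spanning_forests E j) (weight F)%:E.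

Definition min_forests (j : nat) : {set digraph T} :=
  [set F in spanning_forests E j | (weight F)%:E == phi j].

Definition lambda D : \bar R :=
  \big[Order.min/+oo%E]_(G in trees_on E D) (weight G)%:E.

Definition min_trees_on D : {set digraph T} :=
  [set G in trees_on E D | (weight G)%:E == lambda D].

Definition frakA (k : nat) : {set {set T}} :=
  generated_algebra
    [set vset G | G in \bigcup_(F in min_forests k) trees F].

Definition aleph (k : nat) : {set {set T}} := algebra_atoms (frakA k).

Definition labeled_aleph (k : nat) : {set {set T}} :=
  [set A in aleph k |
    [exists F in min_forests k,
      [exists G in trees F, [exists i in A, is_root G i]]]].

End Weights.
End Digraphs.

(* Main.v *)
(* If D is the vertex set of a tree of a forest G, no arc of G enters or leaves
   D, so for any forest F exchanging the arcs of F and G with tails in D yields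
   two forests, with the same total weight.  When phi is affine on [m, k], F and
   G are minimal with l < k and k trees, and D contains no root of F, the
   exchanged forests have l + 1 and k - 1 trees, hence are minimal again.  If
   moreover D misses Z, the first one agrees with F on Z.  Such a D exists: the
   atom Z lies in a single tree of G, at least two trees of G contain no root of
   F when l <= k - 2, and when l = k - 1 the set Z is closed under F, so it
   contains a root of F.  Downward induction on l then reduces everything to
   l = k, where exchanging with a minimal forest with k - 1 trees shows that no
   arc of F leaves Z; as Z lies in one tree of F, it contains exactly one root.
   Finally, once F|Z is a tree without outgoing arcs, it can be replaced by any
   tree on Z, so minimality passes from F to F|Z and back. *)

Require Import Defs.
From mathcomp Require Import all_boot all_order all_algebra.
From mathcomp Require Import constructive_ereal reals.
From mathcomp Require Import zify lra.

Set Implicit Arguments.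
Unset Strict Implicit.
Unset Printing Implicit Defensive.

Import Order.TTheory GRing.Theory Num.Theory.
Local Open Scope ring_scope.

(** A path starting in [D] can never get out, so it suffices to compare the relations on arcs with
    tail in [D]. Taking [e' = e] yields plain stability of [D]. *)
Lemma connect_stable (T : finType) (e e' : rel T) (D : {set T}) (x y : T) :
    {in D, forall i j, e i j -> e' i j /\ j \in D} ->
  x \in D -> connect e x y -> connect e' x y /\ y \in D.
Proof.
move=> De xD /connectP[p + ->]; elim: p x xD => [|z p IHp] x xD /=.
  by rewrite connect0.
case/andP=> /(De x xD)[xz zD] /(IHp z zD)[zy yD]; split=> //.
exact: connect_trans (connect1 xz) zy.
Qed.

(** * Sinks and components of a forest *)

Section Sinks.
Variable T : finType.
Implicit Types (G F : digraph T) (D : {set T}) (E : {set T * T}).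

(** Membership in [vset G] is not asked for, so vertices outside a smaller graph may count too; on
    such graphs the set is intersected with the vertex set. *)
Definition sinks G : {set T} := [set i | [forall j, ~~ has_arc G i j]].

Definition sink_of G (x : T) : T :=
  odflt x [pick r in sinks G | connect (has_arc G) x r].

(* For a sink [r], the vertex set of the tree with root [r]. *)
Definition basin G (r : T) : {set T} := [set x | sink_of G x == r].

Lemma is_forestP G :
  is_forest G <->
  (forall x y z, has_arc G x y -> has_arc G x z -> y = z) /\
  (forall x y, has_arc G x y -> ~~ connect (has_arc G) y x).
Proof.
split=> [/andP[/forallP Gle1 /forall_inP Gac]|[Gfun Gac]].
  split=> [x y z xy xz|x y /Gac //].
  by apply: (card_le1_eqP (Gle1 x)); rewrite inE.
apply/andP; split; last by apply/forall_inP => -[x y] /Gac.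
apply/forallP=> x; apply/card_le1_eqP=> y z.
by rewrite !inE => xy /(Gfun _ _ _ xy).
Qed.

Section Forest.
Variable G : digraph T.
Hypothesis G_forest : is_forest G.

Let Gfun x y z : has_arc G x y -> has_arc G x z -> y = z.
Proof. by case/is_forestP: G_forest => + _; apply. Qed.

Let Gac x y : has_arc G x y -> ~~ connect (has_arc G) y x.
Proof. by case/is_forestP: G_forest => _; apply. Qed.

Lemma sink_ofP x :
  sink_of G x \in sinks G /\ connect (has_arc G) x (sink_of G x).
Proof.
rewrite /sink_of; case: pickP => [r /andP[]//|noroot].
suff [r rS xr]: exists2 r, r \in sinks G & connect (has_arc G) x r.
  by have := noroot r; rewrite rS xr.
(* Induction on the number of vertices reachable from [x]: by acyclicity, following an arc loses at
   least [x] itself. *)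
move: {2}_.+1 (ltnSn #|connect (has_arc G) x|) => n.
elim: n x {noroot} => // n IHn x; rewrite ltnS => le_xn.
have [xS|] := boolP (x \in sinks G); first by exists x; rewrite ?connect0.
rewrite inE negb_forall => /existsP[y /negbNE xy].
have [|r rS yr] := IHn y; last first.
  by exists r => //; apply: connect_trans (connect1 xy) yr.
apply: leq_trans le_xn; apply/proper_card/properP; split.
  by apply/subsetP => z; apply: connect_trans (connect1 xy).
by exists x; rewrite ?inE ?connect0 //; apply: Gac.
Qed.

Lemma connect_sink r y : r \in sinks G -> connect (has_arc G) r y -> r = y.
Proof.
rewrite inE => /forallP rS /connectP[[|z p] /=]; first by [].
by rewrite (negPf (rS z)).
Qed.

(** With at most one arc out of each vertex the walk from [x] is forced, so every [y] met on it
    comes before its end [r]. *)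
Lemma connect_to_sink x y r :
    r \in sinks G -> connect (has_arc G) x r -> connect (has_arc G) x y ->
  connect (has_arc G) y r.
Proof.
move=> rS xr /connectP[p + ->]; elim: p x xr => //= z p IHp x xr /andP[xz].
apply: IHp; case/connectP: xr => [[|t q] /=].
  by move=> _ rx; move: rS; rewrite inE rx => /forallP/(_ z); rewrite xz.
by case/andP=> xt pth ->; apply/connectP; exists q; rewrite -?(Gfun xt xz).
Qed.

Lemma sink_of_eq x r :
  r \in sinks G -> connect (has_arc G) x r -> sink_of G x = r.
Proof.
move=> rS xr; have [uS xu] := sink_ofP x.
exact: connect_sink uS (connect_to_sink rS xr xu).
Qed.

Lemma sink_of_sink r : r \in sinks G -> sink_of G r = r.
Proof. by move=> rS; apply: sink_of_eq. Qed.

Lemma sink_of_arc x y : has_arc G x y -> sink_of G x = sink_of G y.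
Proof.
move=> xy; have [rS yr] := sink_ofP y.
exact: sink_of_eq rS (connect_trans (connect1 xy) yr).
Qed.

(** [sink_of] is constant along arcs in either direction; conversely, two vertices with the same
    sink are joined through it. *)
Lemma connect_uarcE x y : connect (uarc G) x y = (sink_of G x == sink_of G y).
Proof.
apply/idP/eqP => [/connectP[p + ->]|xy].
  elim: p x => //= z p IHp x /andP[xz /IHp <-].
  by case/orP: xz => /sink_of_arc.
have sub u w : connect (has_arc G) u w -> connect (uarc G) u w.
  by apply: connect_sub => {}u {}w uw; apply: connect1; rewrite /uarc uw.
have uarc_sym : connect_sym (uarc G).
  by apply: sym_connect_sym => u w; rewrite /uarc orbC.
have [[_ /sub xr] [_ /sub yr]] := (sink_ofP x, sink_ofP y).
by apply: connect_trans xr _; rewrite xy uarc_sym.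
Qed.

Hypothesis G_arcs : {in arcs G, forall e, (e.1 \in vset G) && (e.2 \in vset G)}.

Lemma sink_of_vset x : x \in vset G -> sink_of G x \in vset G.
Proof.
move=> xG; have [_ xr] := sink_ofP x.
have step : {in vset G, forall i j,
    has_arc G i j -> has_arc G i j /\ j \in vset G}.
  by move=> i _ j ij; case/andP: (G_arcs ij).
by case: (connect_stable step xG xr).
Qed.

Lemma componentsE :
  components G = [set vset G :&: basin G r | r in sinks G :&: vset G].
Proof.
have bE x : [set y in vset G | connect (uarc G) x y]
            = vset G :&: basin G (sink_of G x).
  by apply/setP=> y; rewrite !inE connect_uarcE eq_sym.
apply/setP=> C; apply/imsetP/imsetP => [[x xG ->]|[r /setIP[rS rG] ->]].
  exists (sink_of G x); last exact: bE.
  by rewrite inE sink_of_vset ?andbT //; case: (sink_ofP x).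
by exists r => //; rewrite bE sink_of_sink.
Qed.

Lemma card_components : #|components G| = #|sinks G :&: vset G|.
Proof.
rewrite componentsE card_in_imset // => r s /setIP[rS rG] _.
by move=> /setP/(_ r); rewrite !inE rG sink_of_sink // eqxx => /esym/eqP.
Qed.

End Forest.

(** Trees are counted by their roots, because sinks, unlike components, are easy to follow through
    an exchange of arcs. *)
Lemma spanning_forestsP E j F :
  F \in spanning_forests E j <->
  [/\ arcs F \subset E, is_forest F, vset F = setT & #|sinks F| = j].
Proof.
rewrite inE; split=> [/and4P[/andP[FE Farc] Fforest /eqP FT /eqP <-]|].
  split=> //; rewrite card_components ?FT ?setIT //.
  by move=> e; rewrite !inE.
case=> FE Fforest FT <-; rewrite /subgraph FE Fforest FT eqxx /=.
rewrite card_components // ?FT ?setIT ?eqxx ?andbT //; last first.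
  by move=> e; rewrite !inE.
by apply/forall_inP => e; rewrite !inE.
Qed.

Lemma trees_onP E D G :
  G \in trees_on E D <->
  [/\ arcs G \subset E, {in arcs G, forall e, (e.1 \in D) && (e.2 \in D)},
      is_forest G, vset G = D & #|sinks G :&: D| = 1%N].
Proof.
rewrite inE; split.
  case/and3P => /andP[GE /forall_inP Garc] /andP[Gforest /eqP <-] /eqP <-.
  by rewrite card_components.
case=> GE Garc Gforest GD G1; rewrite /subgraph /is_tree GE Gforest GD.
rewrite card_components ?GD ?G1 ?eqxx ?andbT //; exact/forall_inP.
Qed.

(** * Exchanging the arcs with tails in a given set *)

Definition splice D G F : digraph T :=
  (setT, [set e in arcs G | e.1 \in D] :|: [set e in arcs F | e.1 \notin D]).

Definition out_closed G D := {in D, forall i j, has_arc G i j -> j \in D}.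

Lemma has_arc_splice D G F i j :
  has_arc (splice D G F) i j = if i \in D then has_arc G i j else has_arc F i j.
Proof. by rewrite /has_arc !inE /=; case: (i \in D); rewrite ?andbT ?andbF ?orbF. Qed.

Lemma sinks_splice D G F :
  sinks (splice D G F) = (sinks G :&: D) :|: (sinks F :\: D).
Proof.
apply/setP=> i; rewrite !inE.
have -> : [forall j, ~~ has_arc (splice D G F) i j]
    = if i \in D then i \in sinks G else i \in sinks F.
  by rewrite !inE; case: ifP => iD; apply: eq_forallb => j;
     rewrite has_arc_splice iD.
by rewrite !inE; case: (i \in D); rewrite ?andbT ?andbF ?orbF.
Qed.

Lemma card_sinks_splice D G F :
  #|sinks (splice D G F)| = (#|sinks G :&: D| + #|sinks F :\: D|)%N.
Proof.
rewrite sinks_splice cardsU [X in (_ - X)%N]eq_card0 ?subn0 // => i.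
by rewrite !inE; case: (i \in D); rewrite ?andbF.
Qed.

Lemma spliceC D G F : splice (~: D) G F = splice D F G.
Proof.
by congr pair; rewrite setUC; congr (_ :|: _); apply/setP=> e; rewrite !inE ?negbK.
Qed.

(** A cycle of the splice that meets [D] stays in [D] and is a cycle of [G]; a cycle avoiding [D] is
    a cycle of [F]. *)
Lemma splice_forest D G F :
    is_forest G -> is_forest F -> out_closed G D ->
  is_forest (splice D G F).
Proof.
move=> /is_forestP[Gfun Gac] /is_forestP[Ffun Fac] GD.
apply/is_forestP; split=> [x y z|x y].
  by rewrite !has_arc_splice; case: ifP => _; [exact: Gfun | exact: Ffun].
have D_G : {in D, forall i j,
    has_arc (splice D G F) i j -> has_arc G i j /\ j \in D}.
  by move=> i iD j; rewrite has_arc_splice iD => ij; split=> //; apply: GD ij.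
move=> xy; apply/negP => yx.
have [xD|xD] := boolP (x \in D).
  have [xyG yD] := D_G x xD y xy.
  by have [/(negP (Gac _ _ xyG))] := connect_stable D_G yD yx.
have xyF : has_arc F x y by move: xy; rewrite has_arc_splice (negPf xD).
case/negP: (Fac _ _ xyF); case/connectP: yx xD {xy xyF} => p + ->.
(* The path ends outside [D], so none of its vertices lies in [D], where it would be trapped; all
   its arcs therefore come from [F]. *)
elim: p y => [|z p IHp] y /=; first by rewrite connect0.
case/andP=> yz pth lastD.
have yD : y \notin D.
  apply: contra lastD => yD; have [_ zD] := D_G y yD z yz.
  have z_last : connect (has_arc (splice D G F)) z (last z p).
    by apply/connectP; exists p.
  by case: (connect_stable D_G zD z_last).
apply: connect_trans (IHp _ pth lastD); apply: connect1.
by move: yz; rewrite has_arc_splice (negPf yD).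
Qed.

Lemma splice_spanning E D G F :
    arcs G \subset E -> arcs F \subset E -> is_forest (splice D G F) ->
  splice D G F \in spanning_forests E (#|sinks G :&: D| + #|sinks F :\: D|).
Proof.
move=> /subsetP GE /subsetP FE spl; apply/spanning_forestsP.
split=> //; last exact: card_sinks_splice.
by apply/subsetP=> e; rewrite !inE => /orP[] /andP[] => [/GE|/FE].
Qed.

Lemma basin_arc G r i j :
  is_forest G -> has_arc G i j -> (i \in basin G r) = (j \in basin G r).
Proof. by move=> Gforest /(sink_of_arc Gforest); rewrite !inE => ->. Qed.

Lemma sinks_basin G r :
  is_forest G -> r \in sinks G -> sinks G :&: basin G r = [set r].
Proof.
move=> Gforest rS; apply/setP=> s; rewrite !inE.
apply/andP/eqP => [[sS /eqP <-]|->]; last first.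
  by rewrite sink_of_sink // eqxx; move: rS; rewrite inE.
by rewrite sink_of_sink // inE.
Qed.

Lemma NoutP D G : Nout D G = set0 <-> out_closed G D.
Proof.
split=> [N0 i iD j ij|GD].
  apply: contraPT N0 => jD; apply/eqP/set0Pn; exists j.
  by rewrite inE jD; apply/existsP; exists i; rewrite iD.
apply/setP=> j; rewrite !inE; apply/negP => /andP[/negP jD /existsP[i /andP[iD ij]]].
exact/jD/(GD i).
Qed.

(** * Weights and minimal forests *)

Section Weights.
Variables (R : realType) (v : T -> T -> R).

Definition weight_on D G : R := \sum_(e in arcs G | e.1 \in D) v e.1 e.2.

Lemma weightID D G : weight v G = weight_on D G + weight_on (~: D) G.
Proof.
rewrite /weight (bigID (fun e => e.1 \in D)) /=; congr (_ + _).
by apply: eq_bigl => e; rewrite inE.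
Qed.

Lemma weight_splice D G F :
  weight v (splice D G F) = weight_on D G + weight_on (~: D) F.
Proof.
rewrite (weightID D); congr (_ + _); apply: eq_bigl => e; rewrite !inE;
  by case: (e.1 \in D); rewrite ?andbF ?andbT ?orbF.
Qed.

Lemma weight_splice2 D G F :
  weight v (splice D G F) + weight v (splice D F G) = weight v G + weight v F.
Proof.
rewrite !weight_splice (weightID D G) (weightID D F) addrACA [RHS]addrACA.
by rewrite [X in _ + X]addrC.
Qed.

Variable E : {set T * T}.

Lemma min_forestsP j F :
  F \in min_forests E v j <->
  F \in spanning_forests E j /\
    {in spanning_forests E j, forall G, weight v F <= weight v G}.
Proof.
rewrite inE; split=> [/andP[FS /eqP Fphi]|[FS Fmin]].
  by split=> // G GS; rewrite -lee_fin Fphi; apply: bigmin_le_cond.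
rewrite FS eq_le bigmin_le_cond // andbT.
by apply: le_bigmin => [|G GS]; rewrite ?leey // lee_fin Fmin.
Qed.

Lemma min_trees_onP D F :
  F \in min_trees_on E v D <->
  F \in trees_on E D /\ {in trees_on E D, forall G, weight v F <= weight v G}.
Proof.
rewrite inE; split=> [/andP[FS /eqP Fphi]|[FS Fmin]].
  by split=> // G GS; rewrite -lee_fin Fphi; apply: bigmin_le_cond.
rewrite FS eq_le bigmin_le_cond // andbT.
by apply: le_bigmin => [|G GS]; rewrite ?leey // lee_fin Fmin.
Qed.

Lemma min_forests_ex j (p : R) :
  phi E v j = p%:E -> exists F, F \in min_forests E v j.
Proof.
move=> phiE; have [S0|/set0Pn[F0 F0S]] := eqVneq (spanning_forests E j) set0.
  by move: phiE; rewrite /phi S0 big_set0.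
case: (arg_minP (weight v) F0S) => F FS Fmin.
by exists F; apply/min_forestsP.
Qed.

Lemma phi_ninfty j : phi E v j != -oo%E.
Proof.
apply/eqP => phiE; have : (-oo%E < phi E v j)%E.
  by apply: lt_bigmin; rewrite ?ltNyr // => F _; apply: ltNyr.
by rewrite phiE.
Qed.

Lemma min_forests_phi j F :
  F \in min_forests E v j -> phi E v j = (weight v F)%:E.
Proof. by rewrite inE => /andP[_ /eqP <-]. Qed.

(** The basin and its complement are both closed under [G], so both splices are forests. The basin
    holds one root of [G] and none of [F], which shifts the tree counts by one. The splices together
    weigh as much as the two minima witnessed by [F'] and [G'], so each attains its minimum. *)
Lemma exchange_basin a b F G F' G' r :
    F \in min_forests E v a -> G \in min_forests E v b.+1 ->
    F' \in min_forests E v a.+1 -> G' \in min_forests E v b ->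
    weight v F + weight v G = weight v F' + weight v G' ->
    r \in sinks G -> sinks F :&: basin G r = set0 ->
  splice (basin G r) G F \in min_forests E v a.+1 /\
  splice (basin G r) F G \in min_forests E v b.
Proof.
move=> /min_forestsP[FS _] /min_forestsP[GS _].
move=> /min_forestsP[_ F'min] /min_forestsP[_ G'min] wE rS FD0.
have [FE Ff _ Fa] := iffLR (spanning_forestsP _ _ _) FS.
have [GE Gf _ Gb] := iffLR (spanning_forestsP _ _ _) GS.
set D := basin G r in FD0 *.
have GD : out_closed G D by move=> i iD j /(basin_arc r Gf) <-.
have GcD : out_closed G (~: D).
  by move=> i iD j /(basin_arc r Gf); move: iD; rewrite !in_setC => /[swap] <-.
have card1 : (#|sinks G :&: D| + #|sinks F :\: D|)%N = a.+1.
  by rewrite sinks_basin // cards1 -Fa -(cardsID D (sinks F)) FD0 cards0.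
have card2 : (#|sinks F :&: D| + #|sinks G :\: D|)%N = b.
  rewrite FD0 cards0; apply: succn_inj.
  by rewrite -Gb -(cardsID D (sinks G)) sinks_basin // cards1.
have S1 : splice D G F \in spanning_forests E a.+1.
  by rewrite -card1; apply: splice_spanning => //; apply: splice_forest.
have S2 : splice D F G \in spanning_forests E b.
  rewrite -card2; apply: splice_spanning => //.
  by rewrite -spliceC; apply: splice_forest.
have := weight_splice2 D G F.
have := F'min _ S1; have := G'min _ S2 => le2 le1 wS.
by split; apply/min_forestsP; split=> // H HS;
  [have := F'min _ HS | have := G'min _ HS]; lra.
Qed.

(** Basins of minimal forests with [k] trees are generators of the algebra, so an atom meeting one
    is contained in it. *)
Lemma atom_sub_basin k F (Z : {set T}) z :
    F \in min_forests E v k -> Z \in aleph E v k -> z \in Z ->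
  Z \subset basin F (sink_of F z).
Proof.
move=> FM; have [/spanning_forestsP[_ Ff FT _] _] := iffLR (min_forestsP _ _) FM.
rewrite inE => /and3P[_ _ /forall_inP Zatom] zZ.
set r := sink_of F z; have rS : r \in sinks F by case: (sink_ofP Ff z).
have DA : basin F r \in frakA E v k.
  apply/bigcapP => S' /andP[_ /subsetP]; apply; apply/imsetP.
  exists (induced F (basin F r)) => //; apply/bigcupP; exists F => //.
  apply: imset_f; rewrite componentsE ?FT //; last by move=> e; rewrite !inE.
  by apply/imsetP; exists r; rewrite ?FT ?setTI // inE rS inE.
have zD : z \in basin F r by rewrite inE.
case/orP: (Zatom _ DA) => /eqP ZD; last by apply/setIidPl.
by have := in_set0 z; rewrite -ZD inE zZ zD.
Qed.

(** For a forest [F], this encodes that the restriction to [Z] is a tree which no arc of [F]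
    leaves. *)
Definition rooted F (Z : {set T}) : Prop :=
  out_closed F Z /\ #|sinks F :&: Z| = 1%N.

Lemma out_closed_splice D G F (Z : {set T}) :
  Z :&: D = set0 -> out_closed (splice D G F) Z <-> out_closed F Z.
Proof.
move=> ZD0; have arcE i j : i \in Z -> has_arc (splice D G F) i j = has_arc F i j.
  move=> iZ; rewrite has_arc_splice ifF //.
  by have := in_set0 i; rewrite -ZD0 inE iZ.
by split=> Fc i iZ j ij; apply: (Fc i iZ); rewrite ?arcE // -arcE.
Qed.

Lemma sinks_spliceI D G F (Z : {set T}) :
  Z :&: D = set0 -> sinks (splice D G F) :&: Z = sinks F :&: Z.
Proof.
move=> ZD0; apply/setP=> i; rewrite sinks_splice !inE.
case: (boolP (i \in Z)) => iZ; rewrite ?andbF // !andbT.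
by have := in_set0 i; rewrite -ZD0 inE iZ /= => ->; rewrite andbF.
Qed.

Lemma sink_of_out_closed F (Z : {set T}) z :
  is_forest F -> out_closed F Z -> z \in Z -> sink_of F z \in sinks F :&: Z.
Proof.
move=> Ff FZ zZ; have [rS zr] := sink_ofP Ff z.
have step : {in Z, forall i j, has_arc F i j -> has_arc F i j /\ j \in Z}.
  by move=> i iZ j ij; split=> //; apply: FZ ij.
by rewrite inE rS; case: (connect_stable step zZ zr).
Qed.

(** By pigeonhole some sink [r] of [G] is not the sink of any point of [X], so its basin misses [X].
    The basin containing [Z] meets [X], hence is a different one, and [Z] is missed too. *)
Lemma basin_avoiding G q (Z X : {set T}) :
    is_forest G -> (#|X| < #|sinks G|)%N ->
    Z \subset basin G q -> X :&: Z != set0 ->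
  exists r, [/\ r \in sinks G, X :&: basin G r = set0 & Z :&: basin G r = set0].
Proof.
move=> Gf ltXG /subsetP Zq /set0Pn[s /setIP[sX sZ]].
have /set0Pn[r /setDP[rS rX]] : sinks G :\: sink_of G @: X != set0.
  rewrite setD_eq0; apply: contraL ltXG => /subset_leq_card le.
  by rewrite -leqNgt (leq_trans le) ?leq_imset_card.
have XD0 x : x \in X -> x \notin basin G r.
  by move=> xX; apply: contra rX; rewrite inE => /eqP <-; apply: imset_f.
have rq : q != r by apply: contraNneq (XD0 s sX) => <-; apply: Zq.
exists r; split=> //; apply/setP => x; rewrite in_set0 inE; apply/negP => /andP[].
  by move=> /XD0/negP.
by move=> /Zq; rewrite !inE => /eqP ->; apply/negP.
Qed.

(** * Replacing the tree on a rooted set *)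

Lemma induced_rooted F (Z : {set T}) : rooted F Z -> outres F Z = induced F Z.
Proof.
case=> FZ _; rewrite /outres (iffRL (NoutP Z F) FZ) setU0; congr pair.
apply/setP => -[i j]; rewrite !inE /=; case: (boolP (i \in Z)) => iZ; rewrite ?andbF //=.
by case: (boolP (_ \in arcs F)) => //= ij; rewrite (FZ i iZ).
Qed.

Lemma weight_induced F (Z : {set T}) :
  rooted F Z -> weight v (induced F Z) = weight_on Z F.
Proof.
by move=> FZ; rewrite -induced_rooted //; apply: eq_bigl => e; rewrite inE.
Qed.

Lemma induced_trees_on l F (Z : {set T}) :
    F \in spanning_forests E l -> rooted F Z ->
  induced F Z \in trees_on E Z.
Proof.
move=> /spanning_forestsP[/subsetP FE /is_forestP[Ffun Fac] _ _] [FZ F1].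
have sub i j : has_arc (induced F Z) i j -> has_arc F i j.
  by rewrite /has_arc inE => /andP[].
apply/trees_onP; split=> //.
- by apply/subsetP => e; rewrite inE => /andP[/FE].
- by move=> e; rewrite inE => /andP[].
- apply/is_forestP; split=> [x y z /sub xy /sub|x y /sub/Fac]; first exact: Ffun.
  by apply: contra; apply: connect_sub => i j /sub/connect1.
rewrite -F1; apply: eq_card => i; rewrite !inE.
case: (boolP (i \in Z)) => iZ; rewrite ?andbF // !andbT.
apply: eq_forallb => j; rewrite /has_arc !inE /= iZ /=.
by case: (boolP (_ \in arcs F)) => //= ij; rewrite (FZ i iZ).
Qed.

(** [F] and [G] have one root each in [Z], so the exchange leaves the number of trees unchanged. *)
Lemma splice_tree l F G (Z : {set T}) :
    F \in spanning_forests E l -> rooted F Z -> G \in trees_on E Z ->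
  splice Z G F \in spanning_forests E l /\ induced (splice Z G F) Z = G.
Proof.
move=> /spanning_forestsP[FE Ff _ Fl] [FZ F1] /trees_onP[GE GZ Gf Gv G1]; split.
  have -> : l = (#|sinks G :&: Z| + #|sinks F :\: Z|)%N.
    by rewrite G1 -F1 cardsID.
  apply: splice_spanning => //; apply: splice_forest => // i _ j ij.
  by case/andP: (GZ _ ij).
rewrite [RHS]surjective_pairing; congr pair; first exact/esym.
apply/setP => -[i j]; rewrite !inE /=.
apply/andP/idP => [[/orP[/andP[]//|/andP[_ /negP iZ] /andP[/iZ]]//]|ijG].
by case/andP: (GZ _ ijG) => /= -> ->; rewrite ijG.
Qed.

Lemma weight_trees_on G (Z : {set T}) :
  G \in trees_on E Z -> weight v G = weight_on Z G.
Proof.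
move=> /trees_onP[_ GZ _ _ _]; rewrite (weightID Z) [X in _ + X]big1 ?addr0 // => e.
by rewrite inE => /andP[/GZ/andP[-> _]].
Qed.

Section RootedRestriction.
Variables (l : nat) (Z : {set T}).
Hypothesis Z_rooted : {in min_forests E v l, forall F, rooted F Z}.

Lemma induced_min_trees F :
  F \in min_forests E v l -> induced F Z \in min_trees_on E v Z.
Proof.
move=> FM; have FZ := Z_rooted FM.
have [FS Fmin] := iffLR (min_forestsP _ _) FM.
apply/min_trees_onP; split=> [|G GT]; first exact: induced_trees_on FS FZ.
have [HS HZ] := splice_tree FS FZ GT.
have := Fmin _ HS.
(* The arcs with tails outside [Z] are common to both forests, and their weight cancels. *)
by rewrite (weightID Z F) weight_splice lerD2r weight_induced // (weight_trees_on GT).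
Qed.

Lemma splice_min_trees F G :
    F \in min_forests E v l -> G \in min_trees_on E v Z ->
  splice Z G F \in min_forests E v l /\ induced (splice Z G F) Z = G.
Proof.
move=> FM /min_trees_onP[GT Gmin]; have FZ := Z_rooted FM.
have [FS Fmin] := iffLR (min_forestsP _ _) FM.
have [HS HZ] := splice_tree FS FZ GT; split=> //.
apply/min_forestsP; split=> // H /Fmin; apply: le_trans.
rewrite (weightID Z F) weight_splice lerD2r -(weight_induced FZ) -(weight_trees_on GT).
exact/Gmin/(induced_trees_on FS FZ).
Qed.

End RootedRestriction.

(** * Affinity of [phi] and rootedness at every level *)

Lemma phi_affine m k :
    (phi E v m.-1 - phi E v m > phi E v m - phi E v m.+1)%E ->
    (forall j, (m <= j)%N -> (j < k)%N ->
      (phi E v j - phi E v j.+1 = phi E v m - phi E v m.+1)%E) ->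
    (phi E v k.-1 - phi E v k > phi E v k - phi E v k.+1)%E ->
    (m < k)%N ->
  exists (p : nat -> R) (c : R),
    (forall j, (m <= j)%N -> (j <= k)%N -> phi E v j = (p j)%:E) /\
    (forall j, (m <= j)%N -> (j < k)%N -> p j - p j.+1 = c).
Proof.
move=> gap_m gap_eq gap_k mk.
(* The convention [+oo - +oo = -oo] rules out [y = +oo] whatever [x] is. *)
have fin_left (x y z : \bar R) : (x - y > z -> y != +oo)%E.
  by move: x y z => [x||] [y||] [z||].
have phi_k : phi E v k != +oo%E by apply: fin_left gap_k.
have phi_m : phi E v m != +oo%E by apply: fin_left gap_m.
(* An infinite value at [m.+1] would make the common difference [-oo], but the last difference
   subtracts a finite value from one other than [-oo]. *)
have phi_m1 : phi E v m.+1 != +oo%E.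
  apply/eqP => phiE; have kK : k.-1.+1 = k by lia.
  have m_k1 : (m <= k.-1)%N by lia.
  have := gap_eq k.-1 m_k1; rewrite phiE kK => /(_ (leqnn k)).
  move: phi_k (phi_ninfty k) (phi_ninfty k.-1).
  by case: (phi E v k.-1) (phi E v k) (phi E v m) => [x||] [y||] [z||].
pose c := fine (phi E v m) - fine (phi E v m.+1).
have cE : (phi E v m - phi E v m.+1 = c%:E)%E.
  move: phi_m phi_m1 (phi_ninfty m) (phi_ninfty m.+1); rewrite /c.
  by case: (phi E v m) => // x; case: (phi E v m.+1).
have phi_fin i : (m + i <= k)%N -> phi E v (m + i) \is a fin_num.
  elim: i => [|i IHi] lek; first by rewrite addn0 fin_numE phi_m phi_ninfty.
  have := gap_eq (m + i)%N; rewrite cE -addnS leq_addr => /(_ isT).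
  have /IHi : (m + i <= k)%N by lia.
  case: (phi E v (m + i)) => // x _.
  move=> /(_ ltac:(lia)); move: (phi_ninfty (m + i.+1)).
  by case: (phi E v (m + i.+1)).
have phi_finj j : (m <= j)%N -> (j <= k)%N -> phi E v j \is a fin_num.
  by move=> /subnKC <-; apply: phi_fin.
exists (fine \o phi E v), c; split=> j mj jk /=; first by rewrite fineK ?phi_finj.
apply: EFin_inj; rewrite EFinB !fineK ?phi_finj ?gap_eq // ltnW //.
Qed.

Lemma rooted_min_forests m k (Z : {set T}) :
    (phi E v m.-1 - phi E v m > phi E v m - phi E v m.+1)%E ->
    (forall j, (m <= j)%N -> (j < k)%N ->
      (phi E v j - phi E v j.+1 = phi E v m - phi E v m.+1)%E) ->
    (phi E v k.-1 - phi E v k > phi E v k - phi E v k.+1)%E ->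
    (m < k)%N -> Z \in aleph E v k ->
    {in min_forests E v k.-1, forall F, Nout Z F = set0} ->
  forall l, (m <= l)%N -> (l <= k)%N ->
  {in min_forests E v l, forall F, rooted F Z}.
Proof.
move=> gap_m gap_eq gap_k mk Zatom Zclosed.
have [p [c [pE pc]]] := phi_affine gap_m gap_eq gap_k mk.
clear gap_m gap_eq gap_k.
(* From here on [k] is the predecessor of the original index: the top level is [k.+1], and [Zclosed]
   concerns level [k]. *)
case: k mk Zatom Zclosed pE pc => // k mk Zatom Zclosed pE pc.
rewrite ltnS in mk.
have wE j F : (m <= j)%N -> (j <= k.+1)%N ->
    F \in min_forests E v j -> weight v F = p j.
  by move=> mj jk /min_forests_phi; rewrite pE // => -[].
have [z zZ] : exists z, z \in Z.
  by apply/set0Pn; move: Zatom; rewrite inE => /and3P[].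
have minE j F : F \in min_forests E v j -> is_forest F /\ #|sinks F| = j.
  by case/min_forestsP=> /spanning_forestsP[].
have sinkZ F : is_forest F -> out_closed F Z -> sinks F :&: Z != set0.
  by move=> Ff FZ; apply/set0Pn; exists (sink_of F z); apply: sink_of_out_closed.
(* Both spliced forests are minimal because [phi] is affine on [m, k]. *)
have exchange a b F G r :
    (m <= a)%N -> (a <= k)%N -> (m <= b)%N -> (b <= k)%N ->
    F \in min_forests E v a -> G \in min_forests E v b.+1 ->
    r \in sinks G -> sinks F :&: basin G r = set0 ->
  splice (basin G r) G F \in min_forests E v a.+1 /\
  splice (basin G r) F G \in min_forests E v b.
  move=> ma ak mb bk FM GM rG FD0.
  have [F' F'M] := min_forests_ex (pE a.+1 (leqW ma) ak).
  have [G' G'M] := min_forests_ex (pE b mb (leqW bk)).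
  apply: (exchange_basin FM GM F'M G'M) => //.
  rewrite (wE a F) ?(wE b.+1 G) ?(wE a.+1 F') ?(wE b G') //
    ?(leqW ma) ?(leqW mb) ?(leqW ak) ?(leqW bk) //.
  by have := pc a ma ak; have := pc b mb bk; lra.
have [G GM] := min_forests_ex (pE k.+1 (leqW mk) (leqnn _)).
have [Gf Gk] := minE _ _ GM; have ZG := atom_sub_basin GM Zatom zZ.
suff main d l : (l + d = k.+1)%N -> (m <= l)%N ->
    {in min_forests E v l, forall F, rooted F Z}.
  by move=> l ml lk; apply: (main (k.+1 - l)%N) => //; rewrite subnKC.
elim: d l => [|d IHd] l.
  (* Top level: [H] has one tree fewer than [F] and a root in [Z]. Some basin of [F] thus misses [Z]
     and the roots of [H], and the splice with [k] trees agrees with [F] on [Z]. *)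
  rewrite addn0 => -> _ F FM; have [Ff Fk] := minE _ _ FM.
  have [H HM] := min_forests_ex (pE k mk (leqnSn k)).
  have [Hf Hk] := minE _ _ HM.
  have HZ : out_closed H Z by apply/NoutP/Zclosed.
  have ZF := atom_sub_basin FM Zatom zZ.
  have ltHF : (#|sinks H| < #|sinks F|)%N by rewrite Hk Fk.
  have [r [rF HD0 ZD0]] := basin_avoiding Ff ltHF ZF (sinkZ _ Hf HZ).
  have [_ FHM] := exchange k k H F r mk (leqnn k) mk (leqnn k) HM FM rF HD0.
  have FZ : out_closed F Z.
    by apply/(out_closed_splice H F ZD0)/NoutP/Zclosed.
  (* At most one root, since [Z] lies in a single basin of [F]; at least one, since [Z] is
     closed. *)
  split=> //; apply/eqP; rewrite eqn_leq card_gt0 sinkZ // andbT.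
  rewrite -(cards1 (sink_of F z)) -(sinks_basin Ff (proj1 (sink_ofP Ff z))).
  by apply: subset_leq_card; apply: setIS.
rewrite -addSnnS => ldk ml F FM; have [Ff Fl] := minE _ _ FM.
have lk : (l <= k)%N by rewrite -ltnS -ldk leq_addr.
have [r [rG FD0 ZD0]] :
    exists r, [/\ r \in sinks G, sinks F :&: basin G r = set0
                & Z :&: basin G r = set0].
  move: lk; rewrite leq_eqVlt => /predU1P[lk|lk].
    (* For [l = k], [Zclosed] applies to [F] itself and provides a root in [Z]. *)
    apply: basin_avoiding ZG (sinkZ _ Ff _) => //; first by rewrite Fl Gk lk.
    by apply/NoutP/Zclosed; rewrite /= -lk.
  (* For [l < k], no root of [F] need be known in [Z]; adding [z] makes the avoided set meet [Z],
     and its size, at most [l.+1], is still below [k.+1]. *)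
  have [||r [rG XD0 ZD0]] := basin_avoiding (X := z |: sinks F) Gf _ ZG.
  - by rewrite Gk cardsU1 Fl ltnS (leq_trans _ lk) // -add1n leq_add2r leq_b1.
  - by apply/set0Pn; exists z; rewrite inE setU11.
  by exists r; split=> //; apply/eqP; rewrite -subset0 -XD0 setSI // subsetUr.
have [GFM _] := exchange l k F G r ml lk mk (leqnn k) FM GM rG FD0.
have [Gc G1] := IHd _ ldk (leqW ml) _ GFM.
split; first exact/(out_closed_splice G F ZD0).
by rewrite -(sinks_spliceI G F ZD0).
Qed.

End Weights.
End Sinks.

Theorem theorem9 (R : realType) (T : finType) (E : {set T * T})
    (v : T -> T -> R) (m k : nat) (Z : {set T})
    (V_loopless : loopless E)
    (V_spanning_tree : trees_on E setT != set0)
    (m_ge1 : (1 <= m)%N) (k_le : (k <= #|T| - 1)%N) (km : (1 < k - m)%N)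
    (gap_m : (phi E v m.-1 - phi E v m > phi E v m - phi E v m.+1)%E)
    (gap_eq : forall j : nat, (m <= j)%N -> (j < k)%N ->
      (phi E v j - phi E v j.+1 = phi E v m - phi E v m.+1)%E)
    (gap_k : (phi E v k.-1 - phi E v k > phi E v k - phi E v k.+1)%E)
    (Z_labeled : Z \in labeled_aleph E v k)
    (Z_closed : forall F, F \in min_forests E v k.-1 -> Nout Z F = set0) :
  forall l : nat, (m <= l)%N -> (l <= k)%N ->
    [/\ [set outres F Z | F in min_forests E v l]
          = [set induced F Z | F in min_forests E v l],
        [set induced F Z | F in min_forests E v l] = min_trees_on E v Z,
        forall F, F \in min_forests E v l ->
          outres F Z = induced F Z /\ induced F Z \in min_trees_on E v Z
      & forall G, G \in min_trees_on E v Z ->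
          exists2 Q, Q \in min_forests E v l
                   & outres Q Z = induced Q Z /\ induced Q Z = G].
Proof.
move=> l ml lk; have mk : (m < k)%N by rewrite -subn_gt0 ltnW.
have Zatom : Z \in aleph E v k by move: Z_labeled; rewrite inE => /andP[].
have Zrooted : {in min_forests E v l, forall F, rooted F Z}.
  exact: rooted_min_forests gap_m gap_eq gap_k mk Zatom Z_closed l ml lk.
have outE F : F \in min_forests E v l -> outres F Z = induced F Z.
  by move=> /Zrooted/induced_rooted.
have [p [c [pE _]]] := phi_affine gap_m gap_eq gap_k mk.
(* [phi] is finite at level [l], so a minimal forest exists to receive any given tree on [Z]. *)
have [F0 F0M] := min_forests_ex (pE l ml lk).
have extend G : G \in min_trees_on E v Z ->
    exists2 Q, Q \in min_forests E v l
             & outres Q Z = induced Q Z /\ induced Q Z = G.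
  move=> GM; have [QM QZ] := splice_min_trees Zrooted F0M GM.
  by exists (splice Z G F0) => //; rewrite outE.
split=> [||F FM|//].
- exact: eq_in_imset.
- apply/setP=> G; apply/imsetP/idP => [[F FM ->]|/extend[Q QM [_ <-]]].
    exact: (induced_min_trees Zrooted FM).
  by exists Q.
by rewrite outE //; split=> //; apply: (induced_min_trees Zrooted FM).
Qed.
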